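(* For $K\in\mathcal M$ and $0\le n\le N$ let $(E_p)^n_K=\frac12 g\,(h_K^n)^2$. Let $(h^n,p^n,u^n)_{0\le n\le N}$ be a solution of the scheme described in the context. Then for all $K\in\mathcal M$ and $0\le n\le N-1$, $$\frac1{\delta t}\bigl((E_p)_K^{n+1}-(E_p)_K^n\bigr)+\mathrm{div}_K(E_p^n u^n)+p^n_K\,\mathrm{div}_K(u^n)=-R_K^{n+1},$$ with $$R_K^{n+1}\ge\frac{1}{|K|}\,g\sum_{\sigma\in\mathcal E(K)}|\sigma|\,u^n_{K,\sigma}\,h^n_\sigma\,(h_K^{n+1}-h_K^n).$$
   Context: $\Omega\subset\mathbb R^2$ is a bounded connected open set which is a union of rectangles with edges orthogonal to the canonical basis vectors $e^{(1)},e^{(2)}$. $\mathcal M$ is a conforming structured (possibly non uniform) partition of $\Omega$ into rectangles $K$ with axis-parallel edges; $\mathcal E(K)$ is the set of edges of $K$; $\mathcal E^{(i)}$ is the set of all edges orthogonal to $e^{(i)}$. An edge is internal if $\sigma=K|L=\partial K\cap\partial L$, otherwise it lies on $\partial\Omega$. $|\cdot|$ is the one- or two-dimensional measure; $g>0$ is the gravity constant; $\delta t=T/N>0$ is the time step ($N\ge1$ an integer). Scalar unknowns are one value per cell ($h_K$, $p_K$); the $i$-th velocity component is given by one value $u_{i,\sigma}$ per $\sigma\in\mathcal E^{(i)}$, equal to $0$ on boundary edges. Set $u_{K,\sigma}=u_{i,\sigma}\,n_{K,\sigma}\cdot e^{(i)}$ for $\sigma\in\mathcal E(K)\cap\mathcal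 E^{(i)}$, $n_{K,\sigma}$ being the unit normal outward $K$. The upwind height at $\sigma=K|L$ is $h_\sigma=h_K$ if $u_{K,\sigma}\ge0$ and $h_\sigma=h_L$ otherwise (on boundary edges $u_{K,\sigma}=0$ and the choice of $h_\sigma$ is irrelevant). Discrete divergences: $\mathrm{div}_K(u)=\frac1{|K|}\sum_{\sigma\in\mathcal E(K)}|\sigma|u_{K,\sigma}$, $\mathrm{div}_K(hu)=\frac1{|K|}\sum_{\sigma\in\mathcal E(K)}|\sigma|h_\sigma u_{K,\sigma}$, and $\mathrm{div}_K(E_pu)=\frac1{|K|}\sum_{\sigma\in\mathcal E(K)}|\sigma|(E_p)_\sigma u_{K,\sigma}$ with the upwind value $(E_p)_\sigma=\frac12g\,h_\sigma^2$. The scheme is a time-marching scheme for the shallow water equations; the part of it involved here is: for $0\le n\le N-1$ and all $K\in\mathcal M$, $$\frac1{\delta t}(h_K^{n+1}-h_K^n)+\mathrm{div}_K(h^nu^n)=0,$$ together with $p_K^n=\frac12g(h_K^n)^2$ for $0\le n\le N$ (the velocities $u^{n}$ being obtained from a discrete momentum balance equation, which plays no role in this statement). *)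

(* Defs.v *)
From HB Require Import structures.
From mathcomp Require Import all_boot all_order all_algebra.
From mathcomp Require Import finmap.
From mathcomp Require Import all_classical all_reals all_analysis.
Set Implicit Arguments.
Unset Strict Implicit.
Unset Printing Implicit Defensive.
Import Order.TTheory GRing.Theory Num.Theory.
Import numFieldNormedType.Exports.
Local Open Scope classical_set_scope.
Local Open Scope ring_scope.

(* The directions are i : 'I_2, so that e^(1), e^(2) are [evec 0], [evec 1]. *)
Definition evec (R : realType) (i : 'I_2) : 'rV[R]_2 := delta_mx 0 i.

Definition dotp (R : realType) (a b : 'rV[R]_2) : R :=
  \sum_(j < 2) a 0 j * b 0 j.

Definition bnd (R : realType) (A : set 'rV[R]_2) : set 'rV[R]_2 :=
  closure A `\` A°.

(* An axis-parallel rectangle, possibly flat, is given by its lower left corner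
   [B.1] and its upper right corner [B.2]. *)
Definition box (R : realType) := ('rV[R]_2 * 'rV[R]_2)%type.

Definition cbox (R : realType) (B : box R) : set 'rV[R]_2 :=
  [set x | forall i, B.1 0 i <= x 0 i <= B.2 0 i].

Definition obox (R : realType) (B : box R) : set 'rV[R]_2 :=
  [set x | forall i, B.1 0 i < x 0 i < B.2 0 i].

Definition vertices (R : realType) (B : box R) : set 'rV[R]_2 :=
  [set x | forall i, x 0 i = B.1 0 i \/ x 0 i = B.2 0 i].

Definition area (R : realType) (B : box R) : R :=
  \prod_(i < 2) (B.2 0 i - B.1 0 i).

(* An edge is a box which is flat in one direction, together with that
   direction: [(i, B)] is orthogonal to e^(i). *)
Definition edge (R : realType) := ('I_2 * box R)%type.

Definition eset (R : realType) (s : edge R) : set 'rV[R]_2 := cbox s.2.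

(* The summand of the direction orthogonal to the edge is 0. *)
Definition elen (R : realType) (s : edge R) : R :=
  \sum_(j < 2) (s.2.2 0 j - s.2.1 0 j).

Definition set_coord (R : realType) (x : 'rV[R]_2) (i : 'I_2) (c : R) :
  'rV[R]_2 := \row_j (if j == i then c else x 0 j).

(* The upper ([up = true]) or lower edge of K orthogonal to e^(i). *)
Definition face (R : realType) (K : box R) (i : 'I_2) (up : bool) : edge R :=
  let c := (if up then K.2 else K.1) 0 i in
  (i, (set_coord K.1 i c, set_coord K.2 i c)).

Definition edges (R : realType) (K : box R) : seq (edge R) :=
  [seq face K i up | i <- enum 'I_2, up <- [:: false; true]].

(* n_{K,s}, for s an edge of K *)
Definition normal (R : realType) (K : box R) (s : edge R) : 'rV[R]_2 :=
  if s.2.1 0 s.1 == K.2 0 s.1 then evec R s.1 else - evec R s.1.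

(* s = K|L *)
Definition interface (R : realType) (K L : box R) (s : edge R) : Prop :=
  K <> L /\ eset s = bnd (cbox K) `&` bnd (cbox L).

Definition mesh_edge (R : realType) (M : {fset box R}) (s : edge R) : Prop :=
  exists2 K, K \in M & s \in edges K.

Definition internal (R : realType) (M : {fset box R}) (s : edge R) : Prop :=
  exists K L, [/\ K \in M, L \in M & interface K L s].

Definition rectilinear_domain (R : realType) (Omega : set 'rV[R]_2) : Prop :=
  [/\ open Omega, connected Omega, bounded_set Omega
    & exists D : {fset box R}, Omega = \bigcup_(B in [set` D]) obox B].

Definition conforming (R : realType) (K L : box R) : Prop :=
  [\/ cbox K `&` cbox L = set0,
      exists2 x, vertices K x /\ vertices L x & cbox K `&` cbox L = [set x]
    | exists2 s, s \in edges K /\ s \in edges L & cbox K `&` cbox L = eset s].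

(* The cells can be numbered by pairs of integers in such a way that the
   numbers of two cells adjacent in the direction e^(i) differ by e^(i). *)
Definition structured (R : realType) (M : {fset box R}) : Prop :=
  exists idx : box R -> 'rV[int]_2,
    {in M &, injective idx} /\
    {in M &, forall K L i,
       face K i true = face L i false -> idx L = idx K + delta_mx 0 i}.

Record rect_mesh (R : realType) (Omega : set 'rV[R]_2) (M : {fset box R}) :
    Prop := RectMesh {
  mesh_nonflat : forall K, K \in M -> forall i, K.1 0 i < K.2 0 i ;
  mesh_inside : forall K, K \in M -> obox K `<=` Omega ;
  mesh_cover : closure Omega = \bigcup_(K in [set` M]) cbox K ;
  mesh_disjoint : forall K L, K \in M -> L \in M -> K <> L ->
    obox K `&` obox L = set0 ;
  mesh_conforming : forall K L, K \in M -> L \in M -> K <> L ->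
    conforming K L ;
  mesh_structured : structured M ;
  mesh_external : forall s, mesh_edge M s -> ~ internal M s ->
    eset s `<=` bnd Omega }.

(* A velocity field v assigns the value v_{i,s} = [v i s] to the edges s
   orthogonal to e^(i); its other values are never used. *)
Definition velocity (R : realType) := 'I_2 -> edge R -> R.

(* u_{K,s} *)
Definition nvel (R : realType) (v : velocity R) (K : box R) (s : edge R) : R :=
  v s.1 s * dotp (normal K s) (evec R s.1).

(* The cell L such that s = K|L (unique in a mesh), and K itself if there is
   none. *)
Definition neighbour (R : realType) (M : {fset box R}) (K : box R)
    (s : edge R) : box R :=
  xget K [set L | L \in M /\ interface K L s].

(* h_s, seen from the cell K. When u_{K,s} = 0, the two cells sharing s choose
   different values, but h_s only occurs multiplied by u_{K,s}. *)
Definition upwind (R : realType) (M : {fset box R}) (v : velocity R)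
    (h : box R -> R) (K : box R) (s : edge R) : R :=
  if 0 <= nvel v K s then h K else h (neighbour M K s).

Definition div_vel (R : realType) (v : velocity R) (K : box R) : R :=
  (area K)^-1 * \sum_(s <- edges K) elen s * nvel v K s.

Definition div_mass (R : realType) (M : {fset box R}) (h : box R -> R)
    (v : velocity R) (K : box R) : R :=
  (area K)^-1 * \sum_(s <- edges K) elen s * upwind M v h K s * nvel v K s.

Definition div_Ep (R : realType) (M : {fset box R}) (g : R) (h : box R -> R)
    (v : velocity R) (K : box R) : R :=
  (area K)^-1 *
  \sum_(s <- edges K)
     elen s * (2^-1 * g * upwind M v h K s ^+ 2) * nvel v K s.

Definition Ep (R : realType) (g : R) (h : box R -> R) (K : box R) : R :=
  2^-1 * g * h K ^+ 2.

(* No discrete momentum balance is imposed: the velocities are arbitrary, up to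
   the impermeability condition. *)
Record scheme_solution (R : realType) (M : {fset box R}) (g dt : R) (N : nat)
    (h p : nat -> box R -> R) (u : nat -> velocity R) : Prop := SchemeSolution {
  scheme_impermeable : forall n s, (n <= N)%N ->
    mesh_edge M s -> ~ internal M s -> u n s.1 s = 0 ;
  scheme_mass : forall n K, (n < N)%N -> K \in M ->
    dt^-1 * (h n.+1 K - h n K) + div_mass M (h n) (u n) K = 0 ;
  scheme_pressure : forall n K, (n <= N)%N -> K \in M ->
    p n K = 2^-1 * g * h n K ^+ 2 }.

(* Main.v *)
(* Write [d] for [h_K^{n+1} - h_K^n]. Expanding the square, the mass balance turns
   the left-hand side into
     g/(2|K|) sum_s |s| u_{K,s} (h_s - h_K)^2 + g/(2 dt) d^2,
   where the sum is nonpositive because [h_s = h_K] on outflow edges. The same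
   balance identifies the lower bound claimed for the remainder with
   [- g/dt d^2]. *)
Require Import Defs.
From HB Require Import structures.
From mathcomp Require Import all_boot all_order all_algebra.
From mathcomp Require Import finmap.
From mathcomp Require Import all_classical all_reals all_analysis.
From mathcomp Require Import ring lra.
Set Implicit Arguments.
Unset Strict Implicit.
Unset Printing Implicit Defensive.
Import Order.TTheory GRing.Theory Num.Theory.
Import numFieldNormedType.Exports.
Local Open Scope classical_set_scope.
Local Open Scope ring_scope.

Lemma elen_ge0 (R : realType) (K : box R) (s : edge R) :
  (forall i, K.1 0 i < K.2 0 i) -> s \in edges K -> 0 <= elen s.
Proof.
move=> ltK /allpairsP[[i up] [_ _ ->]]; apply: sumr_ge0 => j _ /=.
by rewrite !mxE; case: ifP; rewrite ?subrr// subr_ge0 ltW.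
Qed.

Lemma area_gt0 (R : realType) (K : box R) :
  (forall i, K.1 0 i < K.2 0 i) -> 0 < area K.
Proof. by move=> ltK; apply: prodr_gt0 => i _; rewrite subr_gt0. Qed.

(** On inflow edges a negative [nvel v K s] multiplies a nonnegative factor; on the others the
    square vanishes. *)
Lemma upwind_dissipation (R : realType) (M : {fset box R}) (v : velocity R)
    (h : box R -> R) (K : box R) :
  (forall i, K.1 0 i < K.2 0 i) ->
  \sum_(s <- edges K) elen s * (upwind M v h K s - h K) ^+ 2 * nvel v K s <= 0.
Proof.
move=> ltK; rewrite big_seq; apply: sumr_le0 => s sK.
rewrite /upwind; case: ifPn => [_|]; first by rewrite subrr expr0n mulr0 mul0r.
rewrite -ltNge => /ltW v_le0.
by rewrite mulr_ge0_le0 // mulr_ge0 ?sqr_ge0 // (elen_ge0 ltK).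
Qed.

(** On each edge, h_s^2/2 + h_K^2/2 - h_K h_s = (h_s - h_K)^2/2, so the two sides differ by g/(2|K|)
    times the sum in [upwind_dissipation]. *)
Lemma div_Ep_le (R : realType) (M : {fset box R}) (g : R) (v : velocity R)
    (h : box R -> R) (K : box R) :
  0 <= g -> (forall i, K.1 0 i < K.2 0 i) ->
  div_Ep M g h v K + Ep g h K * div_vel v K <= g * h K * div_mass M h v K.
Proof.
move=> g_ge0 ltK; rewrite -subr_le0.
suff -> : div_Ep M g h v K + Ep g h K * div_vel v K
      - g * h K * div_mass M h v K
    = 2^-1 * g * (area K)^-1 *
      \sum_(s <- edges K)
         elen s * (upwind M v h K s - h K) ^+ 2 * nvel v K s.
  rewrite mulr_ge0_le0 ?upwind_dissipation // !mulr_ge0 ?invr_ge0 //.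
  exact: ltW (area_gt0 ltK).
rewrite /div_Ep /div_vel /div_mass /Ep !mulr_sumr -sumrN -!big_split /=.
by apply: eq_bigr => s _; field; rewrite gt_eqF ?area_gt0.
Qed.

Theorem lemma4 (R : realType) (Omega : set 'rV[R]_2) (M : {fset box R})
  (g T : R) (N : nat) (h p : nat -> box R -> R) (u : nat -> velocity R)
  (hOmega : rectilinear_domain Omega) (hM : rect_mesh Omega M)
  (hg : 0 < g) (hT : 0 < T) (hN : (1 <= N)%N)
  (hsol : scheme_solution M g (T / N%:R) N h p u) :
  exists Rem : nat -> box R -> R,
    forall (K : box R) (n : nat), K \in M -> (n < N)%N ->
      (T / N%:R)^-1 * (Ep g (h n.+1) K - Ep g (h n) K)
        + div_Ep M g (h n) (u n) K + p n K * div_vel (u n) K = - Rem n.+1 K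
      /\ Rem n.+1 K >=
         (area K)^-1 * g *
         \sum_(s <- edges K)
            elen s * nvel (u n) K s * upwind M (u n) (h n) K s
            * (h n.+1 K - h n K).
Proof.
pose lhs n K := (T / N%:R)^-1 * (Ep g (h n.+1) K - Ep g (h n) K)
  + div_Ep M g (h n) (u n) K + p n K * div_vel (u n) K.
(* The remainder is defined by the equality, which leaves only the bound; [n.-1] appears because
   R^{n+1} is built from the step from n to n+1. *)
exists (fun n K => - lhs n.-1 K) => K n KM nN; split; first by rewrite opprK.
have mass := scheme_mass hsol nN KM.
have dissip := div_Ep_le M (u n) (h n) (ltW hg) (mesh_nonflat hM KM).
rewrite /lhs /= (scheme_pressure hsol (ltnW nN) KM) -/(Ep g (h n) K).
set d := h n.+1 K - h n K in mass *.
set D := div_mass M (h n) (u n) K in mass dissip.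
(* The increment [d] is common to all edges and factors out of the sum. *)
have -> : (area K)^-1 * g * \sum_(s <- edges K)
    elen s * nvel (u n) K s * upwind M (u n) (h n) K s * d = g * D * d.
  rewrite /D /div_mass -mulr_suml.
  under eq_bigr do rewrite mulrAC.
  ring.
have DE : D = - ((T / N%:R)^-1 * d) by lra.
have dt_ge0 : 0 <= (T / N%:R)^-1 by rewrite invr_ge0 divr_ge0 ?ler0n // ltW.
have d2_ge0 : 0 <= g * ((T / N%:R)^-1 * d ^+ 2).
  by rewrite mulr_ge0 ?(ltW hg) // mulr_ge0 ?sqr_ge0.
(* Exact Taylor expansion at h_K^n; divided by dt, its linear term cancels the bound g h_K D of
   [dissip]. *)
have -> : Ep g (h n.+1) K - Ep g (h n) K
    = g * h n K * d + 2^-1 * g * d ^+ 2 by rewrite /Ep /d; field.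
(* It remains to compare g d^2/(2 dt) with g d^2/dt, which is [d2_ge0]. *)
rewrite DE in dissip *; lra.
Qed.
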